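(* Let $n\ge 6$ and let $K_n^k$ be the $k$-th Cartesian power of the complete graph $K_n$, where $k\ge 1$. If $k\leq n+1$, then $\rho'(K_n^k)\leq k\,\rho'(K_n)$.
   Context: $G^k$ denotes the $k$-th Cartesian power of $G$: $G^1=G$ and $G^k=G\square G^{k-1}$, where $\square$ is the Cartesian product of graphs. An edge coloring of a graph is distinguishing if no automorphism other than the identity preserves it. $D'(G)$ is the least number of colors in a distinguishing edge coloring of $G$. When $D'(G)=2$ (this holds for $K_n$ with $n\ge 6$), the cost of edge-distinguishing $\rho'(G)$ is the minimum number of edges in the smaller color class over all distinguishing edge colorings of $G$ with two colors. *)

(* Defs.v *)
From HB Require Import structures.
From mathcomp Require Import all_boot all_fingroup.

Set Implicit Arguments.
Unset Strict Implicit.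
Unset Printing Implicit Defensive.

Record sgraph := SGraph {
  vertex :> finType;
  adj : rel vertex;
  adj_sym : symmetric adj;
  adj_irrefl : irreflexive adj
}.

Section Complete.
Variable n : nat.

Definition complete_rel (x y : 'I_n) := x != y.

Lemma complete_sym : symmetric complete_rel.
Proof. by move=> x y; rewrite /complete_rel eq_sym. Qed.

Lemma complete_irrefl : irreflexive complete_rel.
Proof. by move=> x; rewrite /complete_rel eqxx. Qed.

Definition complete : sgraph := SGraph complete_sym complete_irrefl.

End Complete.

Section CartProd.
Variables G H : sgraph.

Definition cart_rel (u v : G * H) :=
  ((u.1 == v.1) && adj u.2 v.2) || (adj u.1 v.1 && (u.2 == v.2)).

Lemma cart_sym : symmetric cart_rel.
Proof.
move=> u v; rewrite /cart_rel (eq_sym u.1) (eq_sym u.2).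
by rewrite (adj_sym u.1) (adj_sym u.2).
Qed.

Lemma cart_irrefl : irreflexive cart_rel.
Proof. by move=> u; rewrite /cart_rel !adj_irrefl andbF. Qed.

Definition cart_prod : sgraph := SGraph cart_sym cart_irrefl.

End CartProd.

(* The recursion stops at G^1 = G, so that K_n^1 is K_n itself and not       *)
(* K_n [] K_1; the value at k = 0 is the neutral graph K_1.                   *)
Fixpoint cart_pow (G : sgraph) (k : nat) : sgraph :=
  if k is k'.+1 then
    if k' is _.+1 then cart_prod G (cart_pow G k') else G
  else complete 1.

Definition edges (G : sgraph) : {set {set G}} :=
  [set e | [exists x, exists y, adj x y && (e == [set x; y])]].

Definition edge (G : sgraph) : finType := {e : {set G} | e \in edges G}.

Definition automorphism (G : sgraph) (phi : {perm G}) : bool :=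
  [forall x, forall y, adj (phi x) (phi y) == adj x y].

(* An automorphism maps edges to edges, so each e has exactly one e' below.  *)
Definition preserves (G : sgraph) (C : eqType) (phi : {perm G})
    (c : edge G -> C) : bool :=
  [forall e : edge G, forall e' : edge G,
     (val e' == phi @: val e) ==> (c e' == c e)].

Definition distinguishing (G : sgraph) (C : eqType) (c : edge G -> C) : bool :=
  [forall phi : {perm G},
     (automorphism phi && preserves phi c) ==> (phi == 1%g)].

Definition edge_dist_colorable (G : sgraph) (d : nat) : bool :=
  [exists c : {ffun edge G -> 'I_d}, distinguishing c].

(* D'(G). More than #|edge G| colors are never needed; the value is          *)
(* #|edge G|.+1 when G has no distinguishing edge coloring at all (K_2).      *)
Definition edge_dist_number (G : sgraph) : nat :=
  find (edge_dist_colorable G) (iota 0 #|edge G|.+1).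

Definition color_class (G : sgraph) (C : eqType) (c : edge G -> C) (i : C) :
    {set edge G} := [set e | c e == i].

(* rho'(G). The initial value #|edge G| bounds every term, so it does not    *)
(* affect the minimum when there is a distinguishing coloring; only the case  *)
(* D'(G) = 2 is meaningful.                                                   *)
Definition edge_dist_cost (G : sgraph) : nat :=
  \big[minn/#|edge G|]_(c : {ffun edge G -> 'I_2} | distinguishing c)
     minn #|color_class c ord0| #|color_class c ord_max|.

Lemma edge_dist_colorable_card (G : sgraph) (d : nat) :
  edge_dist_colorable G d -> edge_dist_colorable G #|edge G|.
Proof.
case/existsP=> c /forallP dc; apply/existsP; exists [ffun e => enum_rank e].
apply/forallP=> phi; apply/implyP=> /andP[aphi /forallP pphi].
apply: (implyP (dc phi)); rewrite aphi /=.
apply/forallP=> e; apply/forallP=> e'; apply/implyP=> he.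
have /implyP/(_ he) := forallP (pphi e) e'.
by rewrite !ffunE => /eqP/enum_rank_inj->.
Qed.

Lemma edge_dist_numberP (G : sgraph) (d : nat) : edge_dist_colorable G d ->
  edge_dist_colorable G (edge_dist_number G) /\ edge_dist_number G <= d.
Proof.
move=> hd; have hE := edge_dist_colorable_card hd.
have hs : has (edge_dist_colorable G) (iota 0 #|edge G|.+1).
  by apply/hasP; exists #|edge G|; rewrite // mem_iota /= add0n ltnS.
have lt := hs; rewrite has_find size_iota in lt.
split; first by have := nth_find 0 hs; rewrite nth_iota.
rewrite leqNgt; apply/negP=> ltd; have := before_find 0 ltd.
by rewrite nth_iota ?add0n ?hd // (ltn_trans ltd).
Qed.

Lemma edge_dist_cost_le (G : sgraph) (c : {ffun edge G -> 'I_2}) :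
  distinguishing c ->
  edge_dist_cost G <= minn #|color_class c ord0| #|color_class c ord_max|.
Proof.
rewrite /edge_dist_cost => dc; have := mem_index_enum c.
elim: (index_enum _) => //= a s IH; rewrite inE big_cons.
case/orP=> [/eqP<-|/IH le]; first by rewrite dc geq_minl.
by case: ifP => // _; apply: leq_trans (geq_minr _ _) le.
Qed.

Lemma edge_dist_cost_attained (G : sgraph) : edge_dist_colorable G 2 ->
  exists2 c : {ffun edge G -> 'I_2}, distinguishing c &
  edge_dist_cost G = minn #|color_class c ord0| #|color_class c ord_max|.
Proof.
case/existsP=> c0 dc0.
have [|//] : edge_dist_cost G = #|edge G| \/
  exists2 c : {ffun edge G -> 'I_2}, distinguishing c &
  edge_dist_cost G = minn #|color_class c ord0| #|color_class c ord_max|.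
  rewrite /edge_dist_cost; elim/big_ind: _ => [|x y hx hy|c dc]; first by left.
  - by case: (leqP x y).
  - by right; exists c.
move=> eqE; exists c0 => //; apply/eqP; rewrite eqn_leq edge_dist_cost_le //=.
by rewrite eqE geq_min max_card.
Qed.

(* Main.v *)
(* Put one copy of a smallest asymmetric edge set [A] of [K_n] on a line of each
   of the [k] directions, and colour these edges red. An automorphism of the
   Hamming graph permutes the coordinates by some [s] and the symbols of each
   coordinate by some [p i]. If it preserves the red edges, it maps the chosen
   line of direction [i] to the one of direction [s i], and the copy of [A] to
   the copy of [A], so [p i = 1]. The chosen line of direction [i] has [j]-th
   coordinate [t1] if [i < j] and [t0] if [j < i], hence [s] is increasing and
   therefore trivial. *)
Require Import Defs.
From mathcomp Require Import all_boot.
From mathcomp Require Import all_fingroup zify.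

Set Implicit Arguments.
Unset Strict Implicit.
Unset Printing Implicit Defensive.

(** * Automorphisms of Hamming graphs *)

Section Hamming.

Variables I T : finType.
Implicit Types (x y u v w : {ffun I -> T}) (i j d : I) (a b : T).

Definition hadj x y := #|[pred i | x i != y i]| == 1.

Lemma hadjP x y :
  reflect (exists2 d, x d != y d & forall j, j != d -> x j = y j) (hadj x y).
Proof.
apply: (iffP card1P) => [[d dP] | [d xyd dP]]; exists d.
- by have := dP d; rewrite !inE eqxx.
- by move=> j jd; have := dP j; rewrite !inE (negPf jd) => /negbFE/eqP.
- by move=> j; rewrite !inE; case: (eqVneq j d) => [->|/dP->]; rewrite ?eqxx.
Qed.

Definition upd x i a : {ffun I -> T} := [ffun j => if j == i then a else x j].

Lemma upd_same x i a : upd x i a i = a.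
Proof. by rewrite ffunE eqxx. Qed.

Lemma upd_other x i a j : j != i -> upd x i a j = x j.
Proof. by rewrite ffunE => /negPf->. Qed.

Lemma upd_id x i : upd x i (x i) = x.
Proof. by apply/ffunP=> j; rewrite ffunE; case: eqP => [->|]. Qed.

Lemma updK x i a b : upd (upd x i a) i b = upd x i b.
Proof. by apply/ffunP=> j; rewrite !ffunE; case: eqP. Qed.

Lemma updC x i j a b : i != j -> upd (upd x i a) j b = upd (upd x j b) i a.
Proof.
move=> ij; apply/ffunP=> l; rewrite !ffunE.
by case: (eqVneq l j) => // ->; rewrite eq_sym (negPf ij).
Qed.

Lemma hadj_upd x i a : hadj x (upd x i a) = (a != x i).
Proof.
apply/hadjP/idP=> [[d]|ax]; last first.
  by exists i => [|j ji]; rewrite ?upd_same 1?eq_sym // upd_other.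
by rewrite ffunE; case: (d =P i) => [->|]; rewrite ?eqxx // eq_sym.
Qed.

Lemma hadj_upd2 x i a b : hadj (upd x i a) (upd x i b) = (a != b).
Proof. by rewrite -(updK x i a b) hadj_upd upd_same eq_sym. Qed.

(** Turn [x] into [y] one coordinate at a time: a change at a coordinate in [S] is ignored by [F],
    and outside [S] nothing changes. So [F] depends only on the coordinates outside [S]. *)
Lemma upd_invariant (S : pred I) (X : Type) (F : {ffun I -> T} -> X) :
    (forall x j b, S j -> F (upd x j b) = F x) ->
  forall x y, (forall j, ~~ S j -> x j = y j) -> F x = F y.
Proof.
move=> Fupd x y xy.
pose mix (s : seq I) : {ffun I -> T} := [ffun j => if j \in s then y j else x j].
have Fmix s : F (mix s) = F x.
  elim: s => [|j s IH]; first by congr F; apply/ffunP=> j; rewrite ffunE.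
  rewrite -{}IH; have -> : mix (j :: s) = upd (mix s) j (y j).
    by apply/ffunP=> l; rewrite !ffunE inE; case: eqP => [->|].
  case: (boolP (S j)) => [/Fupd-> //|/xy xyj].
  by congr F; apply/ffunP=> l; rewrite !ffunE; case: eqP => // ->; rewrite xyj if_same.
by rewrite -(Fmix (enum I)); congr F; apply/ffunP=> j; rewrite ffunE mem_enum.
Qed.

(** A triangle lies on a line. If [w] left [u] in another direction [e], then at [d] it would keep
    the value of [u], so [v] and [w] would differ at both [d] and [e]. *)
Lemma hadj_triangle u v w d : u d != v d -> (forall j, j != d -> u j = v j) ->
  hadj u w -> hadj v w -> forall j, j != d -> w j = u j.
Proof.
move=> uvd uv /hadjP[e uwe uw] /hadjP[g vwg vw] j jd.
case: (eqVneq e d) => [ed|ed]; first by rewrite -uw // ed.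
have gd : g = d.
  by apply: contraNeq uvd => gd; rewrite uw ?vw // eq_sym.
by move: uwe; rewrite uv // vw ?eqxx // gd.
Qed.

Section Automorphism.

Variables (t0 t1 : T) (t01 : t0 != t1) (f : {ffun I -> T} -> {ffun I -> T}).
Hypotheses (f_inj : injective f) (f_hadj : forall x y, hadj (f x) (f y) = hadj x y).

Let neq_ex a : exists b, b != a.
Proof.
by case: (eqVneq t0 a) => [<-|]; [exists t1; rewrite eq_sym | exists t0].
Qed.

(** The points of a line are pairwise adjacent, hence so are their images, and by [hadj_triangle]
    these stay on the line through two of them. *)
Lemma line_image x i : exists d, forall a j, j != d -> f (upd x i a) j = f x j.
Proof.
have [b bx] := neq_ex (x i).
have /hadjP[d fd fP] : hadj (f x) (f (upd x i b)) by rewrite f_hadj hadj_upd.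
exists d => a j jd.
case: (eqVneq a (x i)) => [->|ax]; first by rewrite upd_id.
case: (eqVneq a b) => [->|ab]; first by rewrite fP.
apply: (hadj_triangle fd fP) => //; first by rewrite f_hadj hadj_upd.
by rewrite f_hadj hadj_upd2 eq_sym.
Qed.

(** The direction [D x i] of the image of the line through [x] in direction [i] turns out not to
    depend on [x]. It gives [s i], and then coordinate [s i] of [f x] depends only on [x i]. *)
Lemma hamming_automorphism :
  exists (s : I -> I) (p : I -> T -> T),
    [/\ injective s, forall i, injective (p i) &
        forall x i, f x (s i) = p i (x i)].
Proof.
have [D' D'P] := @fin_all_exists _ _ _ (fun q : {ffun I -> T} * I => line_image q.1 q.2).
pose D x i := D' (x, i).
have DP x i a j : j != D x i -> f (upd x i a) j = f x j by apply: (D'P (x, i)).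
have Dneq x i a : a != x i -> f (upd x i a) (D x i) != f x (D x i).
  move=> ax; apply: contraNneq ax => fE; rewrite -(upd_same x i a).
  suff -> : upd x i a = x by [].
  by apply: f_inj; apply/ffunP=> j; case: (eqVneq j (D x i)) => [->|/DP].
have Duniq x i a d : f (upd x i a) d != f x d -> d = D x i.
  by apply: contraNeq => /DP->.
(* If directions [i] and [j] had parallel images, the images of [upd x i a] and [upd x j b] would
   lie on one line and so be equal or adjacent, while these two words differ at both [i] and [j]. *)
have D_inj x : injective (D x).
  move=> i j Dij; apply/eqP/negP=> /negP ij.
  have [a ax] := neq_ex (x i); have [b bx] := neq_ex (x j).
  suff : hadj (upd x i a) (upd x j b).
    case/hadjP=> d _ dP; case: (eqVneq i d) => [id|/dP]; last first.
      by rewrite upd_same upd_other // => aE; rewrite aE eqxx in ax.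
    have /dP : j != d by rewrite -id eq_sym.
    by rewrite upd_same upd_other 1?eq_sym // => bE; rewrite bE eqxx in bx.
  rewrite -f_hadj; apply/hadjP; exists (D x i); last first.
    by move=> l ld; rewrite !DP // -Dij.
  apply/eqP=> fE; have /f_inj E : f (upd x i a) = f (upd x j b).
    apply/ffunP=> l; case: (eqVneq l (D x i)) => [->|ld] //.
    by rewrite !DP // -Dij.
  by have := upd_same x i a; rewrite E upd_other // => aE; rewrite aE eqxx in ax.
have D_self x i b : D (upd x i b) i = D x i.
  case: (eqVneq b (x i)) => [->|bx]; first by rewrite upd_id.
  apply/esym/(Duniq _ _ (x i)); rewrite updK upd_id eq_sym.
  exact: Dneq.
(* In the square spanned by the moves at [i] and [j], the move at [j] leaves coordinate [D x i] of
   the image alone, so the side opposite to the move at [i] still changes that coordinate. *)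
have D_upd x j b i : D (upd x j b) i = D x i.
  case: (eqVneq j i) => [->|ji]; first exact: D_self.
  have [a ax] := neq_ex (x i).
  apply/esym/(Duniq _ _ a).
  have -> : f (upd x j b) (D x i) = f x (D x i).
    by apply: DP; rewrite (inj_eq (D_inj x)) eq_sym.
  rewrite updC // DP ?Dneq //.
  by rewrite -(D_self x i a) (inj_eq (D_inj _)) eq_sym.
(* An arbitrary base point, at which [s] and [p] are read off. *)
pose x0 : {ffun I -> T} := [ffun=> t0].
have DE x i : D x i = D x0 i.
  by apply: (@upd_invariant predT _ (D^~ i)) => // *; apply: D_upd.
pose s := D x0; pose p i a := f (upd x0 i a) (s i).
have fE x i : f x (s i) = p i (x i).
  apply: (@upd_invariant (predC1 i) _ (fun x => f x (s i))) => [y j b /= ji|j].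
    by apply: DP; rewrite DE (inj_eq (D_inj x0)) eq_sym.
  by rewrite negbK => /eqP->; rewrite upd_same.
exists s, p; split=> // [|i a b pab]; first exact: D_inj.
case: (eqVneq b a) => // ba.
have := Dneq (upd x0 i a) i b; rewrite upd_same ba => /(_ isT).
by rewrite updK DE -/s !fE !upd_same pab eqxx.
Qed.

End Automorphism.

End Hamming.

(** * Two-colourings described by edge sets *)

Section EdgeSets.

Variable G : sgraph.
Implicit Types (A : {set {set G}}) (e : {set G}) (phi : {perm G}).

(** One colour class of a distinguishing two-colouring, kept as a set of vertex sets to avoid the
    subtype [edge]. Only membership of edges is compared. *)
Definition asymmetric_edge_set A :=
  forall phi, automorphism phi ->
    (forall e, e \in edges G -> (phi @: e \in A) = (e \in A)) -> phi = 1%g.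

Lemma edgesP e : reflect (exists x y, adj x y /\ e = [set x; y]) (e \in edges G).
Proof.
rewrite inE; apply: (iffP existsP) => [[x /existsP[y /andP[xy /eqP]]]|[x [y [xy ->]]]].
  by exists x, y.
by exists x; apply/existsP; exists y; rewrite xy eqxx.
Qed.

Lemma automorphism_adj phi x y : automorphism phi -> adj (phi x) (phi y) = adj x y.
Proof. by move=> /forallP/(_ x)/forallP/(_ y)/eqP. Qed.

Lemma automorphism_edges phi e :
  automorphism phi -> e \in edges G -> phi @: e \in edges G.
Proof.
move=> aut /edgesP[x [y [xy ->]]]; apply/edgesP; exists (phi x), (phi y).
by rewrite automorphism_adj // imsetU1 imset_set1.
Qed.

Lemma preservesP (C : eqType) phi (c : edge G -> C) :
  reflect (forall e e' : edge G, val e' = phi @: val e -> c e' = c e) (preserves phi c).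
Proof.
apply: (iffP forallP) => [H e e' ee'|H e].
  by have /forallP/(_ e')/implyP := H e; rewrite ee' eqxx => /(_ isT)/eqP.
by apply/forallP=> e'; apply/implyP=> /eqP/H->.
Qed.

Lemma asymmetric_edge_set_cost A : asymmetric_edge_set A ->
  edge_dist_colorable G 2 /\ edge_dist_cost G <= #|A|.
Proof.
move=> asymA.
pose c : {ffun edge G -> 'I_2} :=
  [ffun e => if val e \in A then ord_max else ord0].
have dc : distinguishing c.
  apply/forallP=> phi; apply/implyP=> /andP[aut /preservesP pres].
  apply/eqP/asymA => // e eE.
  have := pres (Sub e eE) (Sub (phi @: e) (automorphism_edges aut eE)).
  by rewrite !ffunE !SubK => /(_ erefl); do 2 case: ifP.
split; first by apply/existsP; exists c.
apply: leq_trans (edge_dist_cost_le dc) _; apply: leq_trans (geq_minr _ _) _.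
rewrite -(card_imset _ val_inj); apply/subset_leq_card/subsetP=> _ /imsetP[e + ->].
by rewrite inE ffunE; case: ifP.
Qed.

Lemma cost_asymmetric_edge_set : edge_dist_colorable G 2 ->
  exists A, [/\ A \subset edges G, asymmetric_edge_set A & #|A| = edge_dist_cost G].
Proof.
case/edge_dist_cost_attained=> c dc ->.
have [i ->] : exists i, minn #|color_class c ord0| #|color_class c ord_max| =
    #|color_class c i|.
  by case: leqP => _; [exists ord0 | exists ord_max].
exists (val @: color_class c i); split.
- by apply/subsetP=> _ /imsetP[e _ ->]; apply: valP.
- move=> phi aut pres; apply/eqP; apply: (implyP (forallP dc phi)).
  rewrite aut; apply/preservesP=> e e' ee'.
  have := pres (val e) (valP e); rewrite -ee' !(mem_imset _ _ val_inj) !inE.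
  (* With two colours, one class determines the colouring. *)
  have color2 (a b l : 'I_2) : (a == l) = (b == l) -> a = b.
    by case: a b l => [[|[|?]] ?] [[|[|?]] ?] [[|[|?]] ?] //= _; apply: val_inj.
  exact: color2.
- by rewrite card_imset //; apply: val_inj.
Qed.

(** With fewer than two colours every colouring is constant, so [phi] preserves it. *)
Lemma edge_dist_number2 phi : automorphism phi -> phi != 1%g ->
  edge_dist_colorable G 2 -> edge_dist_number G = 2.
Proof.
move=> aut phi1 /edge_dist_numberP[col]; case: ltngtP => // lt2 _.
case/existsP: col => c /forallP/(_ phi)/implyP; rewrite aut (negPf phi1).
suff -> : preserves phi c by move=> /(_ isT).
apply/preservesP=> e e' _; apply: val_inj => /=.
by case: (c e) (c e') => i hi [j hj] /=; lia.
Qed.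

End EdgeSets.

(** * Powers of complete graphs as Hamming graphs *)

Lemma cart_pow_hamming (n k : nat) : 0 < k ->
  exists h : cart_pow (complete n) k -> {ffun 'I_k -> 'I_n},
    bijective h /\ forall x y, adj x y = hadj (h x) (h y).
Proof.
(* As a sum, the number of differing coordinates splits into the first coordinate and the rest. *)
have hadjE (I T : finType) (x y : {ffun I -> T}) :
    hadj x y = (\sum_i (x i != y i) == 1).
  by rewrite /hadj -sum1_card big_mkcond; congr (_ == _);
    apply: eq_bigr => i _; rewrite inE; case: (_ != _).
(* The induction starts at the first power, where the recursion of [cart_pow] returns the graph
   itself. *)
case: k => // k _; elim: k => [|k [h [[h' hK h'K] hadjh]]].
  pose h x : {ffun 'I_1 -> 'I_n} := [ffun=> x].
  exists h; split.
    exists (fun x : {ffun 'I_1 -> 'I_n} => x ord0) => [x|x]; first by rewrite ffunE.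
    by apply/ffunP=> i; rewrite ffunE (ord1 i).
  by move=> x y; rewrite hadjE big_ord1 !ffunE /= /complete_rel; case: eqP.
pose g (x : cart_pow (complete n) k.+2) : {ffun 'I_k.+2 -> 'I_n} :=
  [ffun i => if unlift ord0 i is Some j then h x.2 j else x.1].
have g0 x : g x ord0 = x.1 by rewrite ffunE unlift_none.
have gS x i : g x (lift ord0 i) = h x.2 i by rewrite ffunE liftK.
exists g; split.
  exists (fun x : {ffun 'I_k.+2 -> 'I_n} => (x ord0, h' [ffun i => x (lift ord0 i)]))
    => [[a x]|x].
    by rewrite g0; congr (_, _); rewrite -[RHS]hK; congr h';
      apply/ffunP=> i; rewrite ffunE gS.
  by apply/ffunP=> i; rewrite ffunE; case: unliftP => [j ->|-> //]; rewrite h'K ffunE.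
move=> x y; rewrite hadjE big_ord_recl !g0.
under eq_bigr => i _ do rewrite !gS.
have -> : adj x y = (x.1 == y.1) && adj x.2 y.2 || (x.1 != y.1) && (x.2 == y.2) by [].
rewrite hadjh hadjE -(can_eq hK).
have -> : (h x.2 == h y.2) = (\sum_(i < k.+1) (h x.2 i != h y.2 i) == 0).
  rewrite sum_nat_eq0; apply/eqP/idP=> [->|/forallP H].
    by apply/forallP=> i; rewrite eqxx.
  by apply/ffunP=> i; apply/eqP; have := H i; rewrite /= eqb0 negbK.
by case: (x.1 == y.1) => //=; case: (\sum_(i < _) _) => [|[]].
Qed.

(** * Order of the coordinates and the red edges *)

Lemma increasing_ord_id (k : nat) (s : 'I_k -> 'I_k) :
  (forall i j, (s i < s j) = (i < j)) -> forall i, s i = i.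
Proof.
move=> incr.
(* A strictly increasing self-map of an initial segment never falls below the identity; this is
   applied to [s] and to its inverse. *)
have ge_id (t : 'I_k -> 'I_k) :
    (forall i j : 'I_k, i < j -> t i < t j) -> forall i : 'I_k, i <= t i.
  move=> tincr [m mk]; elim: m mk => // m IH mk.
  apply: leq_ltn_trans (IH (ltnW mk)) _.
  exact: tincr.
have s_inj : injective s.
  move=> i j sij; apply: val_inj; apply/eqP.
  by rewrite eqn_leq leqNgt -incr sij ltnn leqNgt -incr sij ltnn.
have [t sK tK] := injF_bij s_inj.
move=> i; apply: val_inj; apply/eqP; rewrite eqn_leq; apply/andP; split.
  rewrite -{2}(sK i); apply: ge_id => a b ab.
  by rewrite -incr !tK.
by apply: ge_id => a b; rewrite incr.
Qed.

Section RedEdges.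

Variables (n k : nat).
Notation word := {ffun 'I_k -> 'I_n}.
Variables (G : sgraph) (h : G -> word) (h' : word -> G).
Hypotheses (hK : cancel h h') (h'K : cancel h' h).
Hypothesis adjE : forall x y, adj x y = hadj (h x) (h y).
Variables (t0 t1 : 'I_n) (t01 : t0 != t1).
Variable A : {set {set complete n}}.

(* The lines [i = 0, .., k - 1] through a monotone path from [t1 .. t1] to
   [t0 .. t0]: their position encodes the order of the coordinates. *)
Definition line (i : 'I_k) (a : complete n) : word :=
  [ffun j => if j == i then a else if i < j then t1 else t0].

Definition red : {set {set G}} :=
  [set [set h' (line q.1 a) | a in (q.2 : {set complete n})] | q in setX setT A].

Lemma line_same i a : line i a i = a.
Proof. by rewrite ffunE eqxx. Qed.

Lemma line_other i a j : j != i -> line i a j = if i < j then t1 else t0.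
Proof. by rewrite ffunE => /negPf->. Qed.

Lemma line_inj i : injective (line i).
Proof. by move=> a b ab; rewrite -(line_same i a) ab line_same. Qed.

Lemma card_red : #|red| <= k * #|A|.
Proof.
by apply: leq_trans (leq_imset_card _ _) _; rewrite cardsX cardsT card_ord.
Qed.

Lemma line_edge i a b :
  a != b -> [set h' (line i a); h' (line i b)] \in edges G.
Proof.
move=> ab; apply/edgesP; exists (h' (line i a)), (h' (line i b)); split=> //.
rewrite adjE !h'K; apply/hadjP; exists i; first by rewrite !line_same.
by move=> j ji; rewrite !line_other.
Qed.

Lemma line_image_inj i : injective (fun a => h' (line i a)).
Proof. by move=> a b /(can_inj h'K)/line_inj. Qed.

Lemma redP x y : [set h' x; h' y] \in red -> exists i a b,
  [/\ x = line i a, y = line i b & [set a; b] \in A].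
Proof.
case/imsetP=> -[i e] /setXP[_ eA] /= E.
have xE : h' x \in [set h' (line i a) | a in e] by rewrite -E set21.
have yE : h' y \in [set h' (line i a) | a in e] by rewrite -E set22.
case/imsetP: xE => a _ /(can_inj h'K) xE; case/imsetP: yE => b _ /(can_inj h'K) yE.
exists i, a, b; split=> //; suff <- : e = [set a; b] by [].
by apply: (imset_inj (@line_image_inj i)); rewrite -E xE yE imsetU1 imset_set1.
Qed.

(** An edge of direction [i] is not on another chosen line, since the points of that line share
    their [i]-th coordinate. *)
Lemma red_line i a b : a != b ->
  ([set h' (line i a); h' (line i b)] \in red) = ([set a; b] \in A).
Proof.
move=> ab; apply/idP/idP=> [/redP[j [a' [b' [aE bE]]]]|abA].
  case: (eqVneq i j) => [ij|ij].
    by rewrite -ij in aE bE; rewrite (line_inj aE) (line_inj bE).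
  have := congr1 (fun x : word => x i) aE; rewrite line_same line_other // => ai.
  have := congr1 (fun x : word => x i) bE; rewrite line_same line_other // => bi.
  by rewrite ai bi eqxx in ab.
apply/imsetP; exists (i, [set a; b]); first by rewrite inE /= inE.
by rewrite /= imsetU1 imset_set1.
Qed.

Hypotheses (AE : A \subset edges (complete n)) (asymA : asymmetric_edge_set A).

(** The empty set is preserved by the transposition of [t0] and [t1], hence is not asymmetric. *)
Lemma A_neq0 : exists a b, a != b /\ [set a; b] \in A.
Proof.
have [A0|[e eA]] := set_0Vmem A; last first.
  by have /edgesP[a [b [ab E]]] := subsetP AE _ eA; exists a, b; rewrite -E.
have := asymA (phi := tperm t0 t1); rewrite A0 => /(_ _ _)/permP/(_ t0).
rewrite tpermL perm1 => H; case/eqP: t01; apply/esym/H => [|e _]; last by rewrite !inE.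
by apply/forallP=> x; apply/forallP=> y; rewrite /= /complete_rel (inj_eq perm_inj).
Qed.

Lemma red_asymmetric : asymmetric_edge_set red.
Proof.
move=> phi aut pres.
pose f x := h (phi (h' x)).
have f_inj : injective f.
  by move=> x y /(can_inj hK)/perm_inj/(can_inj h'K).
have f_hadj x y : hadj (f x) (f y) = hadj x y.
  by rewrite -adjE automorphism_adj // adjE !h'K.
have [s [p [s_inj p_inj fE]]] := hamming_automorphism t01 f_inj f_hadj.
have phiE x y : phi @: [set h' x; h' y] = [set h' (f x); h' (f y)].
  by rewrite imsetU1 imset_set1 /f !hK.
have [t sK tK] := injF_bij s_inj.
(* A single red edge on line [i] suffices. Its image is red, so it lies on a chosen line [j]. Its
   ends differ at coordinate [s i], which forces [j = s i]; the other coordinates do not vary along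
   the image line. *)
have f_line i a : f (line i a) = line (s i) (p i a).
  have [a0 [b0 [ab0 abA]]] := A_neq0.
  have := pres _ (line_edge i ab0); rewrite red_line // abA phiE.
  case/redP=> j [a' [b' [aE bE _]]].
  have sij : s i = j.
    apply/eqP/negP=> /negP sij; have := p_inj i a0 b0.
    have := fE (line i a0) i; have := fE (line i b0) i.
    rewrite !line_same aE bE !line_other // => <- <- /(_ erefl) ab0'.
    by rewrite ab0' eqxx in ab0.
  apply/ffunP=> l; rewrite -(tK l); case: (eqVneq (t l) i) => [->|tli].
    by rewrite fE !line_same.
  rewrite fE line_other // -(line_other a0 tli) -fE aE -sij.
  by rewrite !line_other // (inj_eq s_inj).
have p_id i a : p i a = a.
  suff : perm (p_inj i) = 1%g by move/permP/(_ a); rewrite permE perm1.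
  apply: asymA.
    by apply/forallP=> x; apply/forallP=> y; rewrite /= /complete_rel (inj_eq perm_inj).
  move=> e /edgesP[x [y [xy ->]]].
  rewrite -(red_line i xy) -(pres _ (line_edge i xy)) phiE !f_line.
  by rewrite red_line ?(inj_eq (p_inj i)) // imsetU1 imset_set1 !permE.
(* Coordinate [s j] of the image of [line i t0] is [t1] or [t0] according to whether [s i < s j],
   and equals coordinate [j] of [line i t0], which tells whether [i < j]. *)
have s_id : forall i, s i = i.
  apply: increasing_ord_id => i j.
  case: (eqVneq j i) => [->|ji]; first by rewrite !ltnn.
  have := fE (line i t0) j.
  rewrite f_line !p_id !line_other ?(inj_eq s_inj) //.
  by do 2 case: ifP => // _; move/eqP; rewrite ?(negPf t01) // eq_sym (negPf t01).
apply/permP=> v; rewrite perm1; apply: (can_inj hK); apply/ffunP=> i.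
by rewrite -{1}(hK v) -/(f (h v)) -{1}(s_id i) fE p_id.
Qed.

End RedEdges.

(** * A distinguishing two-colouring of the complete graph *)

(* The chord creates a unique triangle [1, 2, 3], with pendant paths of different
   lengths at [1] and [3]; fixing it propagates along the path. *)
Definition chorded_path (x y : nat) :=
  [|| x.+1 == y, y.+1 == x, (x == 1) && (y == 3) | (x == 3) && (y == 1)].

Lemma chorded_path_sym : symmetric chorded_path.
Proof.
move=> x y; apply/or4P/or4P; (case; first by constructor 2);
  by [constructor 1 | rewrite andbC; constructor 4 | rewrite andbC; constructor 3].
Qed.

Lemma chorded_path_triangle x y z :
  chorded_path x y -> chorded_path x z -> chorded_path y z ->
  x = 1 \/ x = 2 \/ x = 3.
Proof.
do 3 (case/or4P=> [/eqP ? | /eqP ? | /andP[/eqP ? /eqP ?] | /andP[/eqP ? /eqP ?]]);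
  lia.
Qed.

Lemma chorded_path_rigid (n : nat) (f : 'I_n -> 'I_n) : 6 <= n -> injective f ->
  (forall x y : 'I_n, x != y -> chorded_path (f x) (f y) = chorded_path x y) ->
  forall x, f x = x.
Proof.
move=> n6 f_inj fP.
pose g m := if insub m is Some x then val (f x) else 0.
have gE (x : 'I_n) : g x = f x.
  by rewrite /g; case: insubP => [u _ /val_inj->|] //; rewrite ltn_ord.
have gP x y : x < n -> y < n -> x != y ->
    chorded_path (g x) (g y) = chorded_path x y /\ g x != g y.
  move=> xn yn xy; rewrite (gE (Ordinal xn)) (gE (Ordinal yn)).
  by split; [apply: fP | rewrite val_eqE (inj_eq f_inj)].
(* The triangle is mapped to itself. Exchanging 1 and 3 would send 4 to 0 and leave only 1, the
   image of 3, for 5: this is where six vertices are used. *)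
have g_base : g 0 = 0 /\ g 1 = 1 /\ g 2 = 2 /\ g 3 = 3.
  have lt6 x : x < 6 -> x < n by move/leq_trans; apply.
  have := gP 0 1 (lt6 0 isT) (lt6 1 isT) isT.
  have := gP 0 2 (lt6 0 isT) (lt6 2 isT) isT.
  have := gP 0 3 (lt6 0 isT) (lt6 3 isT) isT.
  have := gP 1 2 (lt6 1 isT) (lt6 2 isT) isT.
  have := gP 1 3 (lt6 1 isT) (lt6 3 isT) isT.
  have := gP 1 4 (lt6 1 isT) (lt6 4 isT) isT.
  have := gP 2 3 (lt6 2 isT) (lt6 3 isT) isT.
  have := gP 2 4 (lt6 2 isT) (lt6 4 isT) isT.
  have := gP 3 4 (lt6 3 isT) (lt6 4 isT) isT.
  have := gP 3 5 (lt6 3 isT) (lt6 5 isT) isT.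
  have := gP 4 5 (lt6 4 isT) (lt6 5 isT) isT.
  move: (g 0) (g 1) (g 2) (g 3) (g 4) (g 5) => a b c d e u.
  move=> [r45 _] [r35 n35] [r34 _] [r24 n24] [r23 _] [r14 n14] [r13 _] [r12 _].
  move=> [r03 n03] [r02 n02] [r01 _].
  have b13 := chorded_path_triangle r12 r13 r23.
  have c13 : c = 1 \/ c = 2 \/ c = 3.
    by apply: (@chorded_path_triangle c b d); rewrite ?r23 ?r13 1?chorded_path_sym ?r12.
  have d13 : d = 1 \/ d = 2 \/ d = 3.
    by apply: (@chorded_path_triangle d b c); rewrite ?r12 1?chorded_path_sym ?r13 ?r23.
  case: b13 => [bE|[bE|bE]]; case: c13 => [cE|[cE|cE]];
    case: d13 => [dE|[dE|dE]]; subst b c d;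
    move: r01 r02 r03 r12 r13 r14 r23 r24 r34 r35 r45;
    rewrite /chorded_path //=; lia.
suff gid m : m < n -> g m = m by move=> x; apply: ord_inj; rewrite -gE gid.
(* The image of [m.+4] is a neighbour of the fixed vertex [m.+3]; the smaller neighbours, [m.+2] and
   possibly 1, are already images of themselves. *)
elim/ltn_ind: m => -[|[|[|[|m]]]] IH mn; try by case: g_base => ? [? []].
have g_neq x : x < m.+4 -> x <> g m.+4.
  move=> xm; have [|_] := gP x m.+4 (ltn_trans xm mn) mn; first by rewrite ltn_eqF.
  by rewrite (IH x xm (ltn_trans xm mn)) => /eqP.
have [|] := gP m.+3 m.+4 (ltnW mn) mn; first by rewrite ltn_eqF.
rewrite (IH m.+3) ?(ltnW mn) // => adj34 _.
have : chorded_path m.+3 (g m.+4) by rewrite adj34 /chorded_path eqxx.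
case/or4P=> [/eqP // | /eqP[gE'] | /andP[] // | /andP[_ /eqP g1]].
  by case: (g_neq m.+2).
by case: (g_neq 1).
Qed.

Lemma set2_eq (T : finType) (x y a b : T) : [set x; y] = [set a; b] ->
  (x = a /\ y = b) \/ (x = b /\ y = a).
Proof.
move=> E.
have: x \in [set a; b] by rewrite -E set21.
have: y \in [set a; b] by rewrite -E set22.
have: a \in [set x; y] by rewrite E set21.
have: b \in [set x; y] by rewrite E set22.
rewrite !inE; do 4 case/orP=> /eqP ?; subst; auto.
Qed.

Lemma complete_edge_dist_colorable (n : nat) :
  6 <= n -> edge_dist_colorable (complete n) 2.
Proof.
move=> n6.
(* The edges of the chorded path on all [n] vertices. *)
pose A := [set [set q.1; q.2] | q : 'I_n * 'I_n & chorded_path q.1 q.2].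
have AP x y : ([set x; y] \in A) = chorded_path x y.
  apply/imsetP/idP=> [[[a b]]|xy]; last by exists (x, y); rewrite ?inE.
  rewrite inE /= => ab /set2_eq[][-> ->] //.
  by rewrite chorded_path_sym.
have [] // := @asymmetric_edge_set_cost (complete n) A.
move=> phi aut pres; apply/permP=> x; rewrite perm1.
apply: (chorded_path_rigid n6 (@perm_inj _ phi)) => a b ab.
have abE : [set a; b] \in edges (complete n) by apply/edgesP; exists a, b.
by rewrite -!AP -(pres _ abE) imsetU1 imset_set1.
Qed.

(** * Necessity of two colours, and the cost bound *)

Lemma exists_automorphism (n k : nat) : 1 < n -> 0 < k ->
  exists2 phi : {perm cart_pow (complete n) k}, automorphism phi & phi != 1%g.
Proof.
move=> n1 k0; have [h [[h' hK h'K] adjE]] := cart_pow_hamming n k0.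
pose t0 := Ordinal (ltnW n1); pose t1 := Ordinal n1.
(* Exchange two symbols in all coordinates at once. *)
pose w (x : {ffun 'I_k -> 'I_n}) : {ffun 'I_k -> 'I_n} :=
  [ffun i => tperm t0 t1 (x i)].
have wK : involutive w by move=> x; apply/ffunP=> i; rewrite !ffunE tpermK.
have w_inj : injective (fun v => h' (w (h v))).
  by move=> u v /(can_inj h'K)/(inv_inj wK)/(can_inj hK).
exists (perm w_inj).
  apply/forallP=> x; apply/forallP=> y; rewrite !permE !adjE !h'K /hadj.
  apply/eqP; congr (_ == 1); apply: eq_card => i.
  by rewrite !inE !ffunE (inj_eq perm_inj).
apply/eqP=> /permP/(_ (h' [ffun=> t0])); rewrite permE perm1 h'K.
move/(can_inj h'K)/ffunP/(_ (Ordinal k0)).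
by rewrite !ffunE tpermL.
Qed.

Theorem theorem5p14 (n k : nat) (hn : 6 <= n) (hk : 1 <= k) (hkn : k <= n + 1) :
  edge_dist_number (cart_pow (complete n) k) = 2 /\
  edge_dist_cost (cart_pow (complete n) k)
    <= k * edge_dist_cost (complete n).
Proof.
have n1 : 1 < n by lia.
have [phi aut phi1] := exists_automorphism n1 hk.
have [h [[h' hK h'K] adjE]] := cart_pow_hamming n hk.
(* [A] is the smaller class of an optimal colouring of the complete graph, so [card_red] bounds the
   red edges by [k] times its cost. *)
have [A [AE asymA <-]] :=
  cost_asymmetric_edge_set (complete_edge_dist_colorable hn).
pose t0 := Ordinal (ltnW n1); pose t1 := Ordinal n1.
have t01 : t0 != t1 by [].
have [col cost] :=
  asymmetric_edge_set_cost (red_asymmetric hK h'K adjE t01 AE asymA).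
split; first exact: edge_dist_number2 aut phi1 col.
exact: leq_trans cost (card_red _ _ _ _).
Qed.
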